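(* Consider a two-layer multilayer network game with intra-layer matrices $G^{(1)},G^{(2)}\in\mathbb{R}^{N\times N}$ (zero diagonals) and inter-layer matrices $G^{(12)},G^{(21)}\in\mathbb{R}^{N\times N}$. Suppose it is a game of strategic complements, i.e., all entries of $G^{(1)},G^{(2)},G^{(12)},G^{(21)}$ are $\leq0$, and that it has one-way inter-layer connection, i.e., $G^{(12)}=\mathbf{0}$ or $G^{(21)}=\mathbf{0}$. Then the game is guaranteed to have a Nash equilibrium (which is then unique) if and only if $\rho(G^{(l)})<1$ for $l\in\{1,2\}$, where $\rho$ denotes the spectral radius.
   Context: Multilayer network game: there are $N$ agents; agent $i$ chooses an effort $x_i^{(l)}\in\mathbb{R}_{\geq0}$ in each layer $l\in\{1,2\}$. Agent $i$'s utility from layer $l$ (with $k$ the other layer) is $$u_i^{(l)}=b_i^{(l)}\Bigl(x_i^{(l)}+\sum_{j=1}^N g^{(l)}_{ij}x_j^{(l)}+\sum_{j=1}^N g^{(lk)}_{ij}x_j^{(k)}\Bigr)-c_i^{(l)}x_i^{(l)},$$ and its total utility is $\kappa u_i^{(1)}+(1-\kappa)u_i^{(2)}$. Each benefit function $b_i^{(l)}:\mathbb{R}\to\mathbb{R}$ is twice differentiable, strictly increasing and strictly concave, $c_i^{(l)}>0$, and it is assumed that there is a (necessarily unique) $q_i^{(l)}\in\mathbb{R}$ with $(b_i^{(l)})'(q_i^{(l)})=c_i^{(l)}$. Nash equilibria of the game are the solutions of the linear best-reply system: vectors $\mathbf{x}^*=(\mathbf{x}^{*(1)},\mathbf{x}^{*(2)})\in\mathbb{R}^{2N}_{\geq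 0}$ with $\mathbf{x}^*=\max\{\mathbf{0},\,\mathbf{q}-\mathbf{G}\mathbf{x}^*\}$ componentwise, where $\mathbf{q}=(\mathbf{q}^{(1)},\mathbf{q}^{(2)})$ and $\mathbf{G}=\begin{pmatrix} G^{(1)} & G^{(12)} \\ G^{(21)} & G^{(2)} \end{pmatrix}$. ''Guaranteed'' means: for all admissible benefit functions and unit costs. *)

(* Defs.v *)
From HB Require Import structures.
From mathcomp Require Import all_boot all_order all_algebra.
From mathcomp Require Import all_classical all_reals all_analysis.
From mathcomp Require Import complex.

Set Implicit Arguments.
Unset Strict Implicit.
Unset Printing Implicit Defensive.

Import Order.TTheory GRing.Theory Num.Theory.
Import numFieldNormedType.Exports.

Local Open Scope classical_set_scope.
Local Open Scope ring_scope.

(* Eigenvalues are taken in R[i]; sup is over a finite set of moduli, which is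
   nonempty as soon as 0 < n (sup set0 = 0 covers n = 0). *)
Definition spectral_radius (R : realType) (n : nat) (A : 'M[R]_n) : R :=
  sup [set ComplexField.Normc.normc z | z in
        [set z : R[i] | eigenvalue (map_mx (real_complex R) A) z]].

Definition twice_derivable (R : realType) (f : R -> R) : Prop :=
  (forall t, derivable f t 1) /\ (forall t, derivable (derive1 f) t 1).

Definition strictly_concave (R : realType) (f : R -> R) : Prop :=
  forall s t a : R, s != t -> 0 < a < 1 ->
    a * f s + (1 - a) * f t < f (a * s + (1 - a) * t).

Definition benefit_function (R : realType) (f : R -> R) : Prop :=
  [/\ twice_derivable f, {homo f : s t / s < t} & strictly_concave f].

(* Benefits b, unit costs c and target levels q of the N agents in one layer;
   q is determined by b and c because each derivative is injective. *)
Definition admissible_layer (R : realType) (N : nat)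
    (b : 'I_N -> R -> R) (c q : 'cV[R]_N) : Prop :=
  forall i, [/\ benefit_function (b i), 0 < c i 0 & derive1 (b i) (q i 0) = c i 0].

Definition nash_equilibrium (R : realType) (n : nat)
    (G : 'M[R]_n) (q x : 'cV[R]_n) : Prop :=
  (forall i, 0 <= x i 0) /\
  (forall i, x i 0 = Num.max 0 ((q - G *m x) i 0)).

(* [P] holds of the set of Nash equilibria of the two-layer game, whatever the
   admissible benefit functions and unit costs. *)
Definition guaranteed (R : realType) (N : nat) (G1 G2 G12 G21 : 'M[R]_N)
    (P : ('cV[R]_(N + N) -> Prop) -> Prop) : Prop :=
  forall (b1 b2 : 'I_N -> R -> R) (c1 c2 q1 q2 : 'cV[R]_N),
    admissible_layer b1 c1 q1 -> admissible_layer b2 c2 q2 ->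
    P (nash_equilibrium (block_mx G1 G12 G21 G2) (col_mx q1 q2)).

Definition guaranteed_nash (R : realType) (N : nat) (G1 G2 G12 G21 : 'M[R]_N) : Prop :=
  guaranteed G1 G2 G12 G21 (fun NE => exists x, NE x).

Definition guaranteed_unique_nash (R : realType) (N : nat)
    (G1 G2 G12 G21 : 'M[R]_N) : Prop :=
  guaranteed G1 G2 G12 G21 (fun NE => exists! x, NE x).

(* Main.v *)
(* Put B = - G >= 0. Everything reduces to the existence of w > 0 with B w < w:
   pairing |u| with w bounds the eigenvalues of B below 1; following the solution
   of (1 - t B) w = 1 from t = 0 to t = 1 produces w when no real eigenvalue is
   >= 1; and w makes the best-reply map have a supersolution and its fixed points
   comparable. An equilibrium for q = 1 is itself such a w for each layer, and
   one-way coupling lets one glue the two layer weights after rescaling one. *)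
Require Import Defs.
From mathcomp Require Import all_boot all_order all_algebra.
From mathcomp Require Import all_classical all_reals all_analysis.
From mathcomp Require Import complex ring lra.

Import Order.TTheory GRing.Theory Num.Theory.
Import numFieldNormedType.Exports.

Local Open Scope ring_scope.

(** * Comparison principle and spectral radius for nonnegative matrices *)

Section NonnegativeMatrices.
Context {R : realType} {n : nat}.
Implicit Types (B : 'M[R]_n) (q v w x y : 'cV[R]_n).

Lemma ler_mulmx_col B x y : (forall i j, 0 <= B i j) ->
  (forall i, x i 0 <= y i 0) -> forall i, (B *m x) i 0 <= (B *m y) i 0.
Proof. by move=> B0 xy i; rewrite !mxE ler_sum// => j _; rewrite ler_wpM2l. Qed.

(** At an index i minimising y/w, a negative minimum m would give y_i >= (B y)_i >= m (B w)_i > m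
    w_i = y_i. *)
Lemma supersolution_ge0 B w y : (forall i j, 0 <= B i j) ->
  (forall i, 0 < w i 0) -> (forall i, (B *m w) i 0 < w i 0) ->
  (forall i, (B *m y) i 0 <= y i 0) -> forall i, 0 <= y i 0.
Proof.
move=> B0 w0 Bw By i0.
case: (@Order.TotalTheory.arg_minP _ R 'I_n i0 predT (fun i => y i 0 / w i 0) isT).
move=> i _ imin.
have ratio j : y i 0 / w i 0 * w j 0 <= y j 0 by rewrite -ler_pdivlMr ?imin.
have [yi|yi] := leP 0 (y i 0); first by
  apply: le_trans (ratio i0); rewrite mulr_ge0// ?divr_ge0// ltW.
have m0 : y i 0 / w i 0 < 0 by rewrite pmulr_llt0 ?invr_gt0.
have := @ler_mulmx_col B (y i 0 / w i 0 *: w) y B0.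
move=> /(_ _ i); rewrite -scalemxAr mxE => H.
have {}H := le_trans (H (fun j => ltac:(rewrite mxE; exact: ratio))) (By i).
have : y i 0 / w i 0 * (B *m w) i 0 > y i 0.
  by rewrite -[ltLHS](divfK (lt0r_neq0 (w0 i))) ltr_nM2l.
by rewrite ltNge H.
Qed.

(* [eigenvalue] refers to left eigenvectors [u], so [w] weights the sum
   [\sum_j `|u j| * w j] rather than a maximum of ratios. *)
Lemma eigenvalue_normc_le (G : 'M[R]_n) w (a : R) (z : R[i]) :
  (forall i, 0 < w i 0) ->
  (forall i, \sum_j `|G i j| * w j 0 <= a * w i 0) ->
  eigenvalue (map_mx (real_complex R) G) z -> ComplexField.Normc.normc z <= a.
Proof.
move=> w0 Gw /eigenvalueP[u uG u0].
pose N := @ComplexField.Normc.normc R.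
have N0 (c : R[i]) : 0 <= N c by case: c => p q; rewrite /N /= sqrtr_ge0.
have Nreal (r : R) : N (real_complex R r) = `|r|.
  by rewrite /N /= expr0n /= addr0 sqrtr_sqr.
have Nsum (F : 'I_n -> R[i]) : N (\sum_i F i) <= \sum_i N (F i).
  elim/big_ind2 : _ => [|a1 b1 a2 b2 h1 h2|//].
    by rewrite /N ComplexField.Normc.normc0.
  by apply: le_trans (le_normcD _ _) _; rewrite lerD.
have S0 : 0 < \sum_j N (u 0 j) * w j 0.
  have [j uj] : exists j, u 0 j != 0 by apply/rV0Pn.
  rewrite (bigD1 j)//= ltr_wpDr ?sumr_ge0// => [k _|]; first by rewrite mulr_ge0// ltW.
  rewrite mulr_gt0// lt_neqAle N0 andbT eq_sym; apply: contra_neq uj.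
  exact: ComplexField.Normc.eq0_normc.
(* With S the weighted sum, |z| S = sum_j |(u G)_j| w_j <= sum_i |u_i| sum_j |G_ij| w_j <= a S. *)
rewrite -(ler_pM2r S0) mulr_sumr.
apply: (@le_trans _ _ (\sum_j (\sum_i N (u 0 i) * `|G i j|) * w j 0)).
  apply: ler_sum => j _; rewrite mulrA; apply: ler_wpM2r; first exact: ltW.
  move/matrixP/(_ 0 j): uG; rewrite !mxE => uG.
  rewrite -[X in X <= _]ComplexField.Normc.normcM -uG.
  apply: le_trans (Nsum _) _; apply: ler_sum => i _.
  by rewrite mxE /N ComplexField.Normc.normcM -/N Nreal.
under eq_bigr do rewrite mulr_suml.
rewrite exchange_big /= mulr_sumr; apply: ler_sum => i _.
under eq_bigr do rewrite -mulrA.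
by rewrite -mulr_sumr mulrCA ler_wpM2l.
Qed.

(** [sup] is an upper bound only for a set bounded above; the constant weight 1 bounds all moduli by
    the sum of the |G_ij|. *)
Lemma eigenvalue_le_spectral_radius (G : 'M[R]_n) (z : R[i]) :
  eigenvalue (map_mx (real_complex R) G) z ->
  ComplexField.Normc.normc z <= spectral_radius G.
Proof.
move=> Gz; apply: ub_le_sup; last by exists z.
exists (\sum_i \sum_j `|G i j|) => _ [c Gc <-].
apply: (@eigenvalue_normc_le G (const_mx 1)) => // i; first by rewrite mxE.
rewrite mxE mulr1; under eq_bigr do rewrite mxE mulr1.
rewrite [leRHS](bigD1 i)//= lerDl sumr_ge0// => k _.
by rewrite sumr_ge0.
Qed.

Lemma spectral_radius_lt1 (G : 'M[R]_n) w : (forall i, 0 < w i 0) ->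
  (forall i, \sum_j `|G i j| * w j 0 < w i 0) -> spectral_radius G < 1.
Proof.
move=> w0 Gw.
(* The largest of finitely many ratios below 1, with default 0, is a bound whose strictness survives
   the [sup]. *)
pose a : R := \big[Num.max/0]_i ((\sum_j `|G i j| * w j 0) / w i 0).
have a1 : a < 1 by apply: bigmax_lt => // i _; rewrite ltr_pdivrMr ?mul1r.
rewrite /spectral_radius; set E := image _ _.
have [->|E0] := eqVneq E set0; first by rewrite sup0.
apply: le_lt_trans a1; apply: ge_sup; first exact/set0P.
move=> _ [z Gz <-]; apply: eigenvalue_normc_le Gz => // i.
rewrite -ler_pdivrMr//; exact: le_bigmax.
Qed.

Lemma real_eigenvalue_spectral_radius (G : 'M[R]_n) (a : R) :
  eigenvalue G a -> `|a| <= spectral_radius G.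
Proof.
move=> /eigenvalueP[u uG u0].
have -> : `|a| = ComplexField.Normc.normc (real_complex R a).
  by rewrite /= expr0n /= addr0 sqrtr_sqr.
apply: eigenvalue_le_spectral_radius; apply/eigenvalueP.
exists (map_mx (real_complex R) u); last by rewrite map_mx_eq0.
by rewrite -map_mxM uG map_mxZ.
Qed.

(* The solution stays nonnegative up to the first singular [t], and the inverse of
   such a [t] is an eigenvalue of [B]. *)
Lemma semipositive_of_eigenvalues_lt1 B : (forall i j, 0 <= B i j) ->
  (forall a, 1 <= a -> ~~ eigenvalue B a) ->
  exists2 w : 'cV[R]_n, forall i, 0 < w i 0 & forall i, (B *m w) i 0 < w i 0.
Proof.
move=> B0 Beig.
(* An inequality suffices here: by comparison, a supersolution at t forces the exact solution at t
   to be nonnegative. *)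
pose good (t : R) (w : 'cV[R]_n) := forall i, 0 <= w i 0 /\ 1 + t * (B *m w) i 0 <= w i 0.
pose T := [set t : R | 0 <= t <= 1 /\ exists w, good t w]%classic.
have Bw0 (w : 'cV[R]_n) : (forall i, 0 <= w i 0) -> forall i, 0 <= (B *m w) i 0.
  by move=> ? i; rewrite mxE sumr_ge0// => j _; rewrite mulr_ge0.
have T0 : T 0.
  split; first by rewrite lexx ler01.
  by exists (const_mx 1) => i; rewrite mul0r addr0 mxE.
have T1 : has_ubound T by exists 1 => t [/andP[]].
have Tdown s t : 0 <= s <= t -> T t -> T s.
  move=> /andP[s0 st] [/andP[t0 t1] [w wP]]; split.
    by rewrite s0 (le_trans st).
  exists w => i; have [wi ti] := wP i; split => //.
  apply: le_trans ti; rewrite lerD2l ler_wpM2r// Bw0// => j.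
  by case: (wP j).
pose tau := sup T.
have tau0 : 0 <= tau by exact: ub_le_sup.
have tau1 : tau <= 1 by apply: ge_sup => [|t [/andP[]]//]; exists 0.
pose M (t : R) : 'M[R]_n := 1%:M - t *: B.
have detM t : 0 <= t <= 1 -> \det (M t) != 0.
  move=> /andP[t0 t1]; apply/negP => /det0P[u u0].
  rewrite mulmxBr mulmx1 -scalemxAr => /eqP; rewrite subr_eq0 => /eqP uB.
  have tn0 : t != 0 by apply: contra_neq u0 => tz; rewrite uB tz scale0r.
  have tp : 0 < t by rewrite lt_neqAle eq_sym tn0.
  have := Beig t^-1; rewrite invf_ge1// => /(_ t1) /negP; apply.
  by apply/eigenvalueP; exists u => //; rewrite [in RHS]uB scalerA mulVf// scale1r.
pose one : 'cV[R]_n := const_mx 1.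
pose PM : 'M[{poly R}]_n := 1%:M - 'X *: map_mx polyC B.
have PME t : map_mx (horner_eval t) PM = M t.
  apply/matrixP => i j; rewrite !mxE /horner_eval !hornerE/=.
  by rewrite hornerMn hornerE.
(* On [0, 1] the value of [p i] at t is det(M t)^2 times entry i of the solution [y t] below, so it
   has the same sign; as a polynomial it is continuous in t. *)
pose p i : {poly R} := \det PM * (\adj PM *m map_mx polyC one) i 0.
have pE t i : (p i).[t] = \det (M t) * (\adj (M t) *m one) i 0.
  rewrite /p hornerM -[(\det PM).[t]]/(horner_eval t _) -det_map_mx PME; congr (_ * _).
  rewrite -[LHS]/(horner_eval t _).
  have -> : \adj (M t) *m one = map_mx (horner_eval t) (\adj PM *m map_mx polyC one).
    rewrite map_mxM map_mx_adj PME; congr (_ *m _).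
    by apply/matrixP => i0 j0; rewrite !mxE /= /horner_eval hornerC.
  by rewrite [in RHS]mxE.
pose y t := (\det (M t))^-1 *: (\adj (M t) *m one).
have My t : 0 <= t <= 1 -> M t *m y t = one.
  by move=> tb; rewrite -scalemxAr mulmxA mul_mx_adj
    mul_scalar_mx scalerA mulVf ?detM// scale1r.
have yE t : 0 <= t <= 1 -> forall i, y t i 0 = 1 + t * (B *m y t) i 0.
  move=> tb i; have /matrixP/(_ i 0) := My t tb.
  rewrite mulmxBl mul1mx -scalemxAl !mxE => <-.
  by rewrite -addrA [X in _ + X](_ : _ = 0) ?addr0// addNr.
have yp t : 0 <= t <= 1 -> forall i, (0 <= y t i 0) = (0 <= (p i).[t]).
  move=> tb i; have d0 := detM t tb; rewrite pE [y t i 0]mxE.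
  have -> : (\det (M t))^-1 = \det (M t) / \det (M t) ^+ 2 by field.
  by rewrite mulrAC pmulr_lge0// invr_gt0 exprn_even_gt0.
have y0 t : T t -> forall i, 0 <= y t i 0.
  move=> [tb [w wP]]; have /andP[t0 t1] := tb.
  have tBE (x : 'cV[R]_n) i : ((t *: B) *m x) i 0 = t * (B *m x) i 0.
    by rewrite -scalemxAl mxE.
  have tB0 i j : 0 <= (t *: B) i j by rewrite mxE mulr_ge0.
  have w1 i : 1 + t * (B *m w) i 0 <= w i 0 by have [] := wP i.
  (* The supersolution [w] at t is itself a positive weight with t B w < w. *)
  apply: (supersolution_ge0 (t *: B) w) => // i; rewrite ?tBE.
  - apply: lt_le_trans (w1 i); rewrite ltr_pwDl// mulr_ge0// Bw0// => j.
    by have [] := wP j.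
  - by apply: lt_le_trans (w1 i); rewrite ltrDr.
  - by rewrite [leRHS](yE t)// lerDr.
have ytau i : 0 <= y tau i 0.
  (* A negative value at [tau] would persist at some t of [T] close to the supremum. *)
  rewrite yp ?tau0// leNgt; apply/negP => ptau.
  have /(_ tau) := @continuous_horner R (p i).
  move=> /cvgr_lt /(_ 0 ptau) /nbhs_ballP[e /= e0 pe].
  have [t Tt et] := sup_adherent e0 (conj (ex_intro _ 0 T0) T1).
  have ttau : t <= tau by exact: ub_le_sup.
  have /pe : ball tau e t.
    by rewrite /ball /= ger0_norm ?subr_ge0// ltrBlDr -ltrBlDl.
  by rewrite /= ltNge -yp ?y0//; case: Tt.
have ytauE := yE tau; rewrite tau0 tau1 in ytauE.
have {}ytauE := ytauE isT.
have [tauE|taul1] := eqVneq tau 1.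
  rewrite tauE in ytau ytauE; exists (y 1) => i; rewrite [ltRHS]ytauE mul1r.
    by rewrite ltr_pwDl// Bw0.
  by rewrite ltrDr.
have {taul1}taul1 : tau < 1 by rewrite lt_neqAle taul1.
pose C := 1 + \sum_i (B *m y tau) i 0.
have By0 := Bw0 _ ytau.
have BC i : (B *m y tau) i 0 <= C.
  rewrite /C (bigD1 i)//= addrCA lerDl addr_ge0// sumr_ge0//.
have C0 : 0 < C by rewrite ltr_pwDl// sumr_ge0.
(* Doubling the solution frees one unit of slack: 2 y(tau) works at tau + e once e (B y(tau))_i <=
   1/2, which e <= 1/(2C) ensures. This contradicts the supremum. *)
pose e := Num.min (1 - tau) (2 * C)^-1.
have e0 : 0 < e by rewrite lt_min subr_gt0 taul1 invr_gt0 mulr_gt0.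
suff /(ub_le_sup T1) : T (tau + e) by rewrite -/tau gerDl leNgt e0.
split; first by rewrite addr_ge0 ?(ltW e0)//= -lerBrDl ge_min lexx.
exists (2 *: y tau) => i; split; first by rewrite mxE mulr_ge0.
rewrite -scalemxAr mxE [(2 *: y tau) i 0]mxE [y tau i 0]ytauE.
have eB : e * (B *m y tau) i 0 <= 2^-1.
  apply: le_trans (_ : (2 * C)^-1 * C <= _).
    by rewrite ler_pM// ?(ltW e0)// ge_min lexx orbT.
  by rewrite invfM -mulrA mulVf ?mulr1// gt_eqF.
move: eB; set b := (B *m _) i 0 => eB; lra.
Qed.

(** An eigenvalue a of [- G] gives the eigenvalue -a of [G], bounded in modulus by the spectral
    radius; conversely, the entries of [- G] are the |G_ij|. *)
Lemma spectral_radius_lt1P (G : 'M[R]_n) : (forall i j, G i j <= 0) ->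
  spectral_radius G < 1 <->
  exists2 w : 'cV[R]_n, forall i, 0 < w i 0 & forall i, (- G *m w) i 0 < w i 0.
Proof.
move=> G0; split=> [rG|[w w0 Gw]].
  apply: semipositive_of_eigenvalues_lt1 => [i j|a a1]; first by rewrite mxE oppr_ge0.
  apply/negP => /eigenvalueP[u uG u0].
  have /real_eigenvalue_spectral_radius : eigenvalue G (- a).
    by apply/eigenvalueP; exists u => //; rewrite scaleNr -uG mulmxN opprK.
  by rewrite normrN leNgt (lt_le_trans rG)// (le_trans a1)// ler_norm.
apply: (spectral_radius_lt1 G w) => // i; apply: le_lt_trans (Gw i).
by rewrite mxE ler_sum// => j _; rewrite !mxE ler0_norm.
Qed.

(** * Equilibria of the best-reply map *)

(** The gap w - B w is positive in every row, so a large multiple of it exceeds v. This serves both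
    to bound best replies and to rescale a layer weight. *)
Lemma scaled_supersolution B w v : (forall i, (B *m w) i 0 < w i 0) ->
  exists2 k, 0 < k & forall i, v i 0 + k * (B *m w) i 0 < k * w i 0.
Proof.
move=> Bw; pose d i := w i 0 - (B *m w) i 0.
have d0 i : 0 < d i by rewrite subr_gt0.
have vd0 i : 0 <= `|v i 0| / d i by rewrite divr_ge0// ltW.
exists (1 + \sum_i `|v i 0| / d i); first by rewrite ltr_pwDl// sumr_ge0.
move=> i; rewrite -ltrBrDr -mulrBr -/(d i).
apply: le_lt_trans (ler_norm _) _.
rewrite mulrDl mul1r ltr_pwDl// -ler_pdivrMr// (bigD1 i)//= lerDl.
by rewrite sumr_ge0.
Qed.

(* Existence is Knaster-Tarski: the pointwise infimum of all supersolutions is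
   a fixed point of the monotone best-reply map. *)
Lemma nash_equilibrium_exists_unique (G : 'M[R]_n) q w : (forall i j, G i j <= 0) ->
  (forall i, 0 < w i 0) -> (forall i, (- G *m w) i 0 < w i 0) ->
  exists! x, nash_equilibrium G q x.
Proof.
move=> G0 w0 Gw; pose B := - G.
have B0 i j : 0 <= B i j by rewrite mxE oppr_ge0.
pose F (x : 'cV[R]_n) i := Num.max 0 (q i 0 + (B *m x) i 0).
have FE x i : Num.max 0 ((q - G *m x) i 0) = F x i.
  by rewrite /F mulNmx mxE.
have Fle x y : (forall i, x i 0 <= y i 0) -> forall i, F x i <= F y i.
  by move=> xy i; rewrite ge_max !le_max lexx /= lerD2l ler_mulmx_col ?orbT.
(* Truncation at 0 is nondecreasing and 1-Lipschitz; uniqueness rests on this bound. *)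
have FB x y i : F x i - F y i <= (B *m \col_j `|x j 0 - y j 0|) i 0.
  have Bxy : (B *m x) i 0 - (B *m y) i 0 <= (B *m \col_j `|x j 0 - y j 0|) i 0.
    have -> : (B *m x) i 0 - (B *m y) i 0 = (B *m (x - y)) i 0 by rewrite mulmxBr !mxE.
    by apply: ler_mulmx_col => // j; rewrite !mxE ler_norm.
  have B00 : 0 <= (B *m \col_j `|x j 0 - y j 0|) i 0.
    by rewrite mxE sumr_ge0// => j _; rewrite mulr_ge0// mxE.
  rewrite lerBlDr ge_max; apply/andP; split.
    by rewrite addr_ge0// le_max lexx.
  rewrite -lerBlDl le_max; apply/orP; right; lra.
pose S := [set y : 'cV[R]_n | forall i, F y i <= y i 0]%classic.
have S0 y : S y -> forall i, 0 <= y i 0.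
  by move=> Sy i; apply: le_trans (Sy i); rewrite le_max lexx.
have [k k0 kw] := scaled_supersolution B w q Gw.
(* This member of [S] makes the infima below range over nonempty sets. *)
have Skw : S (k *: w).
  move=> i; rewrite /F -scalemxAr [(k *: w) i 0]mxE [(k *: (B *m w)) i 0]mxE.
  by rewrite ge_max mulr_ge0 ?ltW//= /B kw.
pose z : 'cV[R]_n := \col_i inf [set y i 0 | y in S]%classic.
have zle y : S y -> forall i, z i 0 <= y i 0.
  move=> Sy i; rewrite mxE; apply: ge_inf; last by exists y.
  by exists 0 => _ [x Sx <-]; exact: S0.
have Sz : S z.
  move=> i; rewrite [leRHS]mxE; apply: lb_le_inf.
    by exists ((k *: w) i 0); exists (k *: w).
  by move=> _ [y Sy <-]; apply: le_trans (Sy i); apply: Fle; exact: zle.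
(* Monotonicity makes [F z] a supersolution too, so minimality of [z] yields z <= F z. *)
have SFz : S (\col_i F z i).
  by move=> i; rewrite [leRHS]mxE; apply: Fle => j; rewrite mxE; exact: Sz.
exists z; split.
  split=> i; first exact: S0.
  rewrite FE; apply/eqP; rewrite eq_le Sz andbT.
  by have := zle _ SFz i; rewrite [leRHS]mxE.
move=> y [_ yF].
have zF i : z i 0 = F z i.
  by apply/eqP; rewrite eq_le Sz andbT; have := zle _ SFz i; rewrite [leRHS]mxE.
have {}yF i : y i 0 = F y i by rewrite -FE -yF.
(* The distance of two fixed points satisfies d <= B d, so B(-d) <= -d and comparison forces d <=
   0. *)
pose d : 'cV[R]_n := \col_j `|z j 0 - y j 0|.
have dE : \col_j `|y j 0 - z j 0| = d by apply/colP => j; rewrite !mxE distrC.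
have dB i : d i 0 <= (B *m d) i 0.
  rewrite [leLHS]mxE ler_norml; apply/andP; split.
    by rewrite lerNl opprB yF zF -dE.
  by rewrite yF zF.
have d0 i : d i 0 <= 0.
  have := supersolution_ge0 B w (- d) B0 w0 Gw.
  have -> : B *m (- d) = - (B *m d) by rewrite mulmxN.
  move=> /(_ _ i); rewrite [(- d) i 0]mxE oppr_ge0; apply => j.
  by rewrite [(- (B *m d)) j 0]mxE [(- d) j 0]mxE lerN2.
apply/colP => i; apply/eqP; rewrite -subr_eq0 -normr_le0.
by have := d0 i; rewrite mxE.
Qed.

(** For x >= 0, complementarity gives q - G x >= q > 0, so the truncation at 0 is inactive. *)
Lemma nash_equilibrium_pos (G : 'M[R]_n) q x : (forall i j, G i j <= 0) ->
  (forall i, 0 < q i 0) -> nash_equilibrium G q x ->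
  forall i, x i 0 = q i 0 + (- G *m x) i 0.
Proof.
move=> G0 q0 [x0 xE] i.
have Gx : 0 <= (- G *m x) i 0.
  by rewrite mxE sumr_ge0// => j _; rewrite mulr_ge0// mxE oppr_ge0.
rewrite xE mulNmx in Gx *; rewrite !mxE in Gx *.
by rewrite max_r// addr_ge0// ltW.
Qed.

End NonnegativeMatrices.

(** * Exponential benefit functions *)

Lemma is_derive_expRN (R : realType) (t : R) :
  is_derive t 1 (fun t : R => - expR (- t)) (expR (- t)).
Proof.
have H : is_derive t 1 (expR \o -%R) (expR (- t) * -1) by exact: is_derive1_comp.
by have := is_deriveN H; rewrite mulrN1 opprK.
Qed.

(** Strict convexity of exp(-t) comes from its strict tangent inequality at m = a s + (1 - a) t,
    that is exp(r) > 1 + r for r != 0; the tangent values at s and t average to exp(-m). *)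
Lemma benefit_function_expRN (R : realType) :
  benefit_function (fun t : R => - expR (- t)).
Proof.
have D := @is_derive_expRN R.
split.
- split=> [t|t]; first by case: (D t).
  have -> : derive1 (fun t : R => - expR (- t)) = - (fun t => - expR (- t)).
    by apply/funext => s; rewrite derive1E (@derive_val _ _ _ _ _ _ _ (D s)) /= fctE opprK.
  by apply: derivableN; case: (D t).
- by move=> s t st; rewrite ltrN2 ltr_expR ltrN2.
move=> s t a st /andP[a0 a1].
set m := a * s + (1 - a) * t.
have tangent u : u != m -> expR (- m) * (1 + (m - u)) < expR (- u).
  move=> um; have -> : expR (- u) = expR (- m) * expR (m - u) by rewrite -expRD; congr expR; ring.
  by rewrite ltr_pM2l ?expR_gt0// expR_gt1Dx// subr_eq0 eq_sym.
have sm : s != m.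
  rewrite -subr_eq0 (_ : s - m = (1 - a) * (s - t)); last by rewrite /m; ring.
  by apply: mulf_neq0; rewrite subr_eq0// gt_eqF.
have tm : t != m.
  rewrite -subr_eq0 (_ : t - m = a * (t - s)); last by rewrite /m; ring.
  by apply: mulf_neq0; [rewrite gt_eqF|rewrite subr_eq0 eq_sym].
rewrite !mulrN -opprD ltrN2.
have -> : expR (- m) = a * (expR (- m) * (1 + (m - s))) +
                     (1 - a) * (expR (- m) * (1 + (m - t))).
  by rewrite [in m - s]/m [in m - t]/m; ring.
by rewrite ltrD// ltr_pM2l ?subr_gt0// tangent.
Qed.

(** Taking the derivative exp(-q_i) > 0 as unit cost realises any target vector, so a guaranteed
    equilibrium may be tested at any chosen q. *)
Lemma admissible_layer_expRN (R : realType) (N : nat) (q : 'cV[R]_N) :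
  admissible_layer (fun _ t => - expR (- t)) (\col_i expR (- q i 0)) q.
Proof.
move=> i; split; first exact: benefit_function_expRN.
  by rewrite mxE expR_gt0.
by rewrite mxE derive1E (@derive_val _ _ _ _ _ _ _ (is_derive_expRN _ _)).
Qed.

(** * Coupling the two layers *)

(** One layer is unaffected by the other and keeps its weight; a large multiple of the affected
    layer's weight absorbs the cross term. *)
Lemma semipositive_block (R : realType) (N : nat) (A1 A2 A12 A21 : 'M[R]_N)
    (w1 w2 : 'cV[R]_N) :
  A12 = 0 \/ A21 = 0 ->
  (forall i, 0 < w1 i 0) -> (forall i, (A1 *m w1) i 0 < w1 i 0) ->
  (forall i, 0 < w2 i 0) -> (forall i, (A2 *m w2) i 0 < w2 i 0) ->
  exists2 w : 'cV[R]_(N + N), forall i, 0 < w i 0 &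
    forall i, (block_mx A1 A12 A21 A2 *m w) i 0 < w i 0.
Proof.
move=> [->|->] w10 A1w w20 A2w.
  have [k k0 kw] := scaled_supersolution A2 w2 (A21 *m w1) A2w.
  exists (col_mx w1 (k *: w2)) => i.
    have [j ->|j ->] := split_ordP i; rewrite ?col_mxEu ?col_mxEd//.
    by rewrite mxE mulr_gt0.
  rewrite mul_block_col mul0mx addr0 -scalemxAr.
  have [j ->|j ->] := split_ordP i; rewrite ?col_mxEu ?col_mxEd//.
  by have := kw j; rewrite !mxE.
have [k k0 kw] := scaled_supersolution A1 w1 (A12 *m w2) A1w.
exists (col_mx (k *: w1) w2) => i.
  have [j ->|j ->] := split_ordP i; rewrite ?col_mxEu ?col_mxEd//.
  by rewrite mxE mulr_gt0.
rewrite mul_block_col mul0mx add0r -scalemxAr addrC.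
have [j ->|j ->] := split_ordP i; rewrite ?col_mxEu ?col_mxEd//.
by have := kw j; rewrite !mxE.
Qed.

Theorem lemma1 (R : realType) (N : nat) (G1 G2 G12 G21 : 'M[R]_N)
    (diag1 : forall i, G1 i i = 0) (diag2 : forall i, G2 i i = 0)
    (complements : forall i j,
       [/\ G1 i j <= 0, G2 i j <= 0, G12 i j <= 0 & G21 i j <= 0])
    (one_way : G12 = 0 \/ G21 = 0) :
  (guaranteed_nash G1 G2 G12 G21 <->
     spectral_radius G1 < 1 /\ spectral_radius G2 < 1) /\
  (guaranteed_nash G1 G2 G12 G21 -> guaranteed_unique_nash G1 G2 G12 G21).
Proof.
have G1le i j : G1 i j <= 0 by case: (complements i j).
have G2le i j : G2 i j <= 0 by case: (complements i j).
pose G := block_mx G1 G12 G21 G2.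
have Gle i j : G i j <= 0.
  rewrite /G; have [i' ->|i' ->] := split_ordP i; have [j' ->|j' ->] := split_ordP j;
  by rewrite ?block_mxEul ?block_mxEur ?block_mxEdl ?block_mxEdr;
    case: (complements i' j').
have necessity : guaranteed_nash G1 G2 G12 G21 ->
    spectral_radius G1 < 1 /\ spectral_radius G2 < 1.
  (* At this target the equilibrium solves x = 1 - G x, and the constant 1 supplies strictness in
     each layer. *)
  pose q : 'cV[R]_N := const_mx 1.
  move=> /(_ _ _ _ _ q q (admissible_layer_expRN _ _ q) (admissible_layer_expRN _ _ q)).
  move=> [x]; rewrite -/G => xNE.
  have q1 i : col_mx q q i 0 = 1 by rewrite /q col_mx_const mxE.
  have q0 i : 0 < col_mx q q i 0 by rewrite q1.
  have {q0}xE := nash_equilibrium_pos G _ _ Gle q0 xNE.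
  have {xNE}x0 := xNE.1.
  pose x1 := usubmx x; pose x2 := dsubmx x.
  have x1E i : x1 i 0 = x (lshift N i) 0 by rewrite mxE.
  have x2E i : x2 i 0 = x (rshift N i) 0 by rewrite mxE.
  have GxE : - G *m x = col_mx (- G1 *m x1 + - G12 *m x2) (- G21 *m x1 + - G2 *m x2).
    by rewrite -{1}(vsubmxK x) /G opp_block_mx mul_block_col.
  have pos (H : 'M[R]_N) (y : 'cV[R]_N) : (forall i j, H i j <= 0) ->
      (forall i, 0 <= y i 0) -> forall i, 0 <= (- H *m y) i 0.
    move=> H0 y0 i; rewrite mxE sumr_ge0// => j _.
    by rewrite mulr_ge0// mxE oppr_ge0.
  have x10 i : 0 <= x1 i 0 by rewrite x1E.
  have x20 i : 0 <= x2 i 0 by rewrite x2E.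
  (* The cross term - G12 x2 is nonnegative, so x1 >= 1 - G1 x1. *)
  have eq1 i : (- G1 *m x1) i 0 < x1 i 0.
    rewrite x1E xE q1 GxE col_mxEu [X in 1 + X]mxE addrCA ltrDl.
    rewrite ltr_pwDl// pos// => j k; by case: (complements j k).
  have eq2 i : (- G2 *m x2) i 0 < x2 i 0.
    rewrite x2E xE q1 GxE col_mxEd [X in 1 + X]mxE addrA ltrDr.
    rewrite ltr_pwDl// pos// => j k; by case: (complements j k).
  split; apply/spectral_radius_lt1P => //.
    (* The weight is positive because 0 <= - G1 x1 < x1. *)
    by exists x1 => // i; apply: le_lt_trans (eq1 i); exact: pos.
  by exists x2 => // i; apply: le_lt_trans (eq2 i); exact: pos.
have sufficiency : spectral_radius G1 < 1 /\ spectral_radius G2 < 1 ->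
    guaranteed_unique_nash G1 G2 G12 G21.
  move=> [/spectral_radius_lt1P-/(_ G1le)[w1 w10 Gw1]].
  move=> /spectral_radius_lt1P-/(_ G2le)[w2 w20 Gw2].
  have one_wayN : - G12 = 0 \/ - G21 = 0.
    by case: one_way => ->; rewrite oppr0; [left|right].
  have [w w0 Gw] :=
    semipositive_block _ _ _ _ _ _ _ _ one_wayN w10 Gw1 w20 Gw2.
  (* The weight depends on the matrices only, so it serves every target vector. *)
  move=> b1 b2 c1 c2 q1 q2 _ _.
  by apply: (nash_equilibrium_exists_unique _ _ w); rewrite ?opp_block_mx.
split; last by move=> /necessity/sufficiency.
split=> [|/sufficiency uniq b1 b2 c1 c2 q1 q2 adm1 adm2]; first exact: necessity.
by have [x []] := uniq _ _ _ _ _ _ adm1 adm2; exists x.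
Qed.
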